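(* Let $\epsilon>0$ be a constant and for each $n$ let $k=k(n)=\lfloor n^{1/4-\epsilon}\rfloor$. Let $r(n)=n^{o(1)}$. Then there do not exist a constant $c>0$ and a sequence $(\Pi_n)$, where $\Pi_n$ is an $n$-processor $\mathsf{BCAST}(1)$ protocol with at most $r(n)$ rounds, such that for all sufficiently large $n$ the protocol $\Pi_n$ distinguishes between $\mathcal{A}^n_{\mathsf{rand}}$ and $\mathcal{A}^n_k$ with advantage at least $c$. (That is, no $n^{o(1)}$-round $\mathsf{BCAST}(1)$ protocol distinguishes $\mathcal{A}^n_{\mathsf{rand}}$ from $\mathcal{A}^n_k$ with advantage $\Omega(1)$.)
   Context: **Model.** In the $\mathsf{BCAST}(1)$ (Broadcast Congested Clique) model there are $n$ processors numbered $1,\dots,n$, each holding a private input string and having unlimited computational power. Computation proceeds in synchronous rounds; in each round every processor broadcasts a single bit (the same bit to all processors), which may depend on its index, its input, its random bits (independent of the inputs) and all bits broadcast in previous rounds. The transcript is the list of all broadcast bits, together with sender and round. When the input is a matrix $A\in\{0,1\}^{n\times n}$, processor $i$ receives the $i$-th row of $A$. **Distributions.** $\mathcal{A}^n_{\mathsf{rand}}$ is the distribution of $A\in\{0,1\}^{n\times n}$ with $A_{i,i}=0$ for all $i$ and with $A_{i,j}$ ($i\neq j$) independent uniform bits (a uniformly random directed graph). For $C\subseteq[n]$, $\mathcal{A}^n_C$ is $\mathcal{A}^n_{\mathsf{rand}}$ conditioned on $A_{i,j}=1$ for all $i,j\in C$, $i\ne j$. $\mathcal{A}^n_k$ is the mixture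 of the $\mathcal{A}^n_C$ over a uniformly random $C\subseteq[n]$ with $|C|=k$. **Advantage.** A protocol distinguishes $D_1$ from $D_2$ with advantage $\delta$ if, when it is given an input that with probability $1/2$ is drawn from $D_1$ and with probability $1/2$ from $D_2$, a guess computed from its transcript correctly identifies the source distribution with probability $1/2+\delta$. *)

(* Defs.v *)
From HB Require Import structures.
From mathcomp Require Import all_boot all_order all_algebra.
From mathcomp Require Import all_classical all_reals all_analysis.
Set Implicit Arguments.
Unset Strict Implicit.
Unset Printing Implicit Defensive.
Import Order.TTheory GRing.Theory Num.Theory.
Local Open Scope ring_scope.

(* A transcript lists the rounds in chronological order; each round records
   the bit broadcast by every sender. *)
Definition transcript (n : nat) : Type := seq {ffun 'I_n -> bool}.

(* The round number is available to [broadcast] as the size of the history.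
   The number of private random bits per processor is arbitrary but finite. *)
Record protocol (n : nat) : Type := Protocol {
  rounds : nat;
  coins : nat;
  broadcast : 'I_n -> 'rV[bool]_n -> coins.-tuple bool -> transcript n -> bool
}.

Arguments broadcast {n} _ _ _ _ _.

Definition randomness (n : nat) (Pi : protocol n) : finType :=
  {ffun 'I_n -> (coins Pi).-tuple bool}.

Fixpoint run (n : nat) (Pi : protocol n) (A : 'M[bool]_n)
    (rho : randomness Pi) (t : nat) : transcript n :=
  if t is t'.+1 then
    let h := run A rho t' in
    rcons h [ffun i => broadcast Pi i (row i A) (rho i) h]
  else [::].

Definition protocol_transcript (n : nat) (Pi : protocol n) (A : 'M[bool]_n)
    (rho : randomness Pi) : transcript n :=
  run A rho (rounds Pi).

(* Distributions on a finite type are given by their mass functions. *)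

Definition Arand (R : realType) (n : nat) (A : 'M[bool]_n) : R :=
  \prod_(i < n) \prod_(j < n) (if i == j then (~~ A i j)%:R else 2^-1).

Definition conditioned (R : realType) (T : finType) (D : T -> R) (E : pred T)
    (x : T) : R :=
  (if E x then D x else 0) / \sum_(y | E y) D y.

Definition is_clique (n : nat) (C : {set 'I_n}) (A : 'M[bool]_n) : bool :=
  [forall i in C, forall j in C, (i != j) ==> A i j].

Definition Aclique (R : realType) (n : nat) (C : {set 'I_n}) :
    'M[bool]_n -> R :=
  conditioned (@Arand R n) (is_clique C).

Definition Aplanted (R : realType) (n k : nat) (A : 'M[bool]_n) : R :=
  (\sum_(C : {set 'I_n} | #|C| == k) Aclique R C A)
    / #|[set C : {set 'I_n} | #|C| == k]|%:R.

(* The source is a fair bit [b] ([true] for D1), independent of the random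
   bits, which are uniform. *)
Definition success_probability (R : realType) (n : nat) (Pi : protocol n)
    (guess : transcript n -> bool) (D1 D2 : 'M[bool]_n -> R) : R :=
  \sum_(b : bool) 2^-1 *
    \sum_(A : 'M[bool]_n) (if b then D1 A else D2 A) *
      (\sum_(rho : randomness Pi)
         (guess (protocol_transcript A rho) == b)%:R / #|randomness Pi|%:R).

Definition distinguishes (R : realType) (n : nat) (Pi : protocol n)
    (D1 D2 : 'M[bool]_n -> R) (delta : R) : Prop :=
  exists guess : transcript n -> bool,
    success_probability Pi guess D1 D2 = 2^-1 + delta.

Definition clique_size (R : realType) (eps : R) (n : nat) : nat :=
  Num.truncn (n%:R `^ (4^-1 - eps)).

Local Open Scope classical_set_scope.

Definition n_pow_o1 (R : realType) (r : nat -> R) : Prop :=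
  exists f : nat -> R,
    f n @[n --> \oo] --> 0 /\ \forall n \near \oo, r n = n%:R `^ f n.

Local Close Scope classical_set_scope.

Section Sanity.
Variable R : realType.

Lemma Arand_ge0 n (A : 'M[bool]_n) : 0 <= Arand R A.
Proof.
apply: prodr_ge0 => i _; apply: prodr_ge0 => j _.
by case: ifP => _; rewrite ?ler0n // invr_ge0 ler0n.
Qed.

Lemma Arand_sum1 n : \sum_(A : 'M[bool]_n) Arand R A = 1.
Proof.
pose F (p : 'I_n * 'I_n) (b : bool) : R :=
  if p.1 == p.2 then (~~ b)%:R else 2^-1.
have -> : \sum_(A : 'M[bool]_n) Arand R A =
    \sum_(f : {ffun 'I_n * 'I_n -> bool}) \prod_p F p (f p).
  rewrite (reindex (fun f : {ffun 'I_n * 'I_n -> bool} =>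
             \matrix_(i, j) f (i, j))) /=; last first.
    exists (fun A : 'M[bool]_n => [ffun p => A p.1 p.2]) => [f _|A _].
      by apply/ffunP => -[i j]; rewrite ffunE mxE.
    by apply/matrixP => i j; rewrite mxE ffunE.
  apply: eq_bigr => f _; rewrite /Arand pair_bigA /=.
  by apply: eq_bigr => -[i j] _; rewrite /F mxE.
rewrite -(bigA_distr_bigA F) /= big1 // => -[i j] _.
rewrite big_bool /F /=; case: (i == j); rewrite /= ?add0r //.
by rewrite -[2^-1]mul1r -splitr.
Qed.

Lemma clique_mass_gt0 n (C : {set 'I_n}) :
  0 < \sum_(A : 'M[bool]_n | is_clique C A) Arand R A.
Proof.
pose K : 'M[bool]_n := \matrix_(i, j) (i != j).
rewrite (bigD1 K) /=; last first.
  apply/forallP => i; apply/implyP => _; apply/forallP => j.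
  by apply/implyP => _; apply/implyP => ij; rewrite mxE.
rewrite ltr_wpDr //; first by apply: sumr_ge0 => A _; exact: Arand_ge0.
apply: prodr_gt0 => i _; apply: prodr_gt0 => j _.
by rewrite mxE; case: (i == j); rewrite /= ?ltr01 // invr_gt0 ltr0n.
Qed.

Lemma Aclique_sum1 n (C : {set 'I_n}) :
  \sum_(A : 'M[bool]_n) Aclique R C A = 1.
Proof.
rewrite /Aclique /conditioned -mulr_suml -big_mkcond /= divff //.
exact: lt0r_neq0 (clique_mass_gt0 C).
Qed.

Lemma Aplanted_sum1 n k : (k <= n)%N ->
  \sum_(A : 'M[bool]_n) Aplanted R k A = 1.
Proof.
move=> kn; rewrite /Aplanted -mulr_suml exchange_big /=.
rewrite (eq_bigr (fun=> 1)) => [|C _]; last exact: Aclique_sum1.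
rewrite sumr_const -cardsE divff // pnatr_eq0.
rewrite [X in X != _](_ : _ = 'C(n, k)); first by rewrite -lt0n bin_gt0.
by rewrite card_draws card_ord.
Qed.

End Sanity.

(* Main.v *)
Require Import Defs.
From mathcomp Require Import all_boot all_order all_algebra.
From mathcomp Require Import all_classical all_reals all_analysis.
From mathcomp Require Import ring lra.
Import Order.TTheory GRing.Theory Num.Theory.
Local Open Scope ring_scope.
Set Implicit Arguments.
Unset Strict Implicit.

(* Fix the coins.  A transcript t corresponds to a product of sets of rows
   D_1 x ... x D_n, so its likelihood ratio under A_C against A_rand is the
   product over i in C of L_i, where L_i is the density of D_i conditioned on
   ones at C \ i, divided by its density mu_i.  From
   min (1, prod L_i) >= 1 - sum (1 - L_i)^+ the statistical distance is at most
   the sum over i in C of the mean of (1 - L_i)^+, where the mean over t is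
   taken under A_rand and hence independently of C.  So one may average over C
   for each cell D_i separately: C \ i is built by adding random positions one
   at a time, and the level-one inequality for a set of density 2^-d bounds the
   expected relative loss of each addition by about sqrt (d / n).  As processor
   i sends r bits, d is at most r on average.  Altogether the advantage is
   O(k^2 sqrt ((r + 1) / n)).  Square roots are avoided by carrying a free
   parameter lam (sqrt (ab) against a / lam + lam b), eventually set to
   n^(-1/2 + e). *)

(** * Row laws, and the loss from planting one more position *)

Section RowMeasure.
Variables (R : realType) (n : nat).
Implicit Types (i j : 'I_n) (S C J : {set 'I_n}) (x : 'rV[bool]_n).

Lemma sum_row_prod (F : 'I_n -> bool -> R) :
  \sum_(x : 'rV[bool]_n) \prod_j F j (x 0 j) = \prod_j \sum_(b : bool) F j b.
Proof.
rewrite bigA_distr_bigA (reindex (fun f : {ffun 'I_n -> bool} => \row_j f j)).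
  by apply: eq_bigr => f _; apply: eq_bigr => j _; rewrite mxE.
exists (fun x : 'rV[bool]_n => [ffun j => x 0 j]) => [f _|x _].
  by apply/ffunP => j; rewrite ffunE mxE.
by apply/rowP => j; rewrite mxE ffunE.
Qed.

Lemma sum_matrix_prod (F : 'I_n -> 'rV[bool]_n -> R) :
  \sum_(A : 'M[bool]_n) \prod_i F i (row i A) = \prod_i \sum_x F i x.
Proof.
rewrite bigA_distr_bigA.
rewrite (reindex (fun f : {ffun 'I_n -> 'rV[bool]_n} => \matrix_(i, j) f i 0 j)).
  apply: eq_bigr => f _; apply: eq_bigr => i _; congr (F i _).
  by apply/rowP => j; rewrite !mxE.
exists (fun A : 'M[bool]_n => [ffun i => row i A]) => [f _|A _].
  by apply/ffunP => i; rewrite ffunE; apply/rowP => j; rewrite !mxE.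
by apply/matrixP => i j; rewrite !mxE ffunE mxE.
Qed.

Definition row_mass i x : R :=
  \prod_j (if i == j then (~~ x 0 j)%:R else 2^-1).

(* [plant S] is the density, with respect to [row_mass i], of the row measure
   conditioned on ones at the positions of [S] (when [i \notin S]). *)
Definition plant S x : R := \prod_(j in S) (2 * (x 0 j)%:R).

(** This is the probability of [D] under the planted row law only when [i \notin S]; if [i \in S],
    the zero diagonal entry makes it vanish. *)
Definition mass i (D : pred 'rV[bool]_n) S : R :=
  \sum_x row_mass i x * (D x)%:R * plant S x.

Lemma row_mass_ge0 i x : 0 <= row_mass i x.
Proof. by apply: prodr_ge0 => j _; case: ifP => _; rewrite ?invr_ge0 ler0n. Qed.

Lemma plant_ge0 S x : 0 <= plant S x.
Proof. by apply: prodr_ge0 => j _; rewrite mulr_ge0 ?ler0n. Qed.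

Lemma plant0 x : plant finset.set0 x = 1.
Proof. by rewrite /plant big_set0. Qed.

Lemma plantU1 S j x : j \notin S -> plant (j |: S)%SET x = 2 * (x 0 j)%:R * plant S x.
Proof. by move=> jS; rewrite /plant big_setU1. Qed.

Lemma mass_ge0 i D S : 0 <= mass i D S.
Proof.
by apply: sumr_ge0 => x _; rewrite !mulr_ge0 ?row_mass_ge0 ?plant_ge0 ?ler0n.
Qed.

(** The sum factorises over coordinates, and at a position of [J], which avoids [S] and [i], the bit
    is uniform, so [1 - 2 * x_j] is centred. *)
Lemma sum_plant_tilt i S J (lam : R) : i \notin S -> i \notin J ->
  [disjoint S & J] ->
  \sum_(x : 'rV[bool]_n)
     row_mass i x * plant S x * \prod_(j in J) (1 + lam * (1 - 2 * (x 0 j)%:R))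
  = 1.
Proof.
move=> iS iJ SJ.
pose F j (b : bool) : R := (if i == j then (~~ b)%:R else 2^-1) *
   (if j \in S then 2 * b%:R else 1) *
   (if j \in J then 1 + lam * (1 - 2 * b%:R) else 1).
transitivity (\sum_(x : 'rV[bool]_n) \prod_j F j (x 0 j)).
  apply: eq_bigr => x _; rewrite /F !big_split /=.
  by rewrite /plant [in RHS]/= -!big_mkcond.
rewrite sum_row_prod big1 // => j _; rewrite big_bool /F /=.
case: (eqVneq i j) => [<-|ij]; first by rewrite (negPf iS) (negPf iJ); lra.
case: (boolP (j \in S)) => jS; first by rewrite (disjointFr SJ jS); lra.
by case: (j \in J); lra.
Qed.

Lemma sum_plant i S : i \notin S -> \sum_x row_mass i x * plant S x = 1.
Proof.
move=> iS; rewrite -[RHS](@sum_plant_tilt i S finset.set0 0) //; last 2 first.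
- by rewrite finset.in_set0.
- by rewrite -finset.setI_eq0 finset.setI0.
by apply: eq_bigr => x _; rewrite big_set0 mulr1.
Qed.

Lemma mass_le1 i D S : i \notin S -> mass i D S <= 1.
Proof.
move=> iS; rewrite -(sum_plant iS); apply: ler_sum => x _.
have := mulr_ge0 (row_mass_ge0 i x) (plant_ge0 S x).
by case: (D x); rewrite ?mulr1 // mulr0 mul0r.
Qed.

Lemma mass_predT i S : i \notin S -> mass i predT S = 1.
Proof.
by move=> iS; rewrite -(sum_plant iS); apply: eq_bigr => x _; rewrite mulr1.
Qed.

(** Inverting [1 + v <= expR v] at [v = 2 u^2 - u] leaves [1 <= (1 + u) (1 - u + 2 u^2) = 1 + u^2 (1
    + 2 u)], whence the range of [u]. *)
Lemma expR_sub_le1D (u : R) : - 2^-1 <= u -> expR (u - 2 * u ^+ 2) <= 1 + u.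
Proof.
move=> u2; have H : 0 < 1 - u + 2 * u ^+ 2 by nra.
rewrite -[u - _]opprK expRN -[leRHS]invrK lef_pV2 ?posrE ?expR_gt0 //; last first.
  by rewrite invr_gt0; lra.
apply: le_trans (expR_ge1Dx _).
rewrite -[_^-1]mul1r ler_pdivrMr; last by lra.
nra.
Qed.

(* Under [row_mass i] conditioned on [S], the test function
   [\prod_(j in J) (1 + lam * (1 - 2 x_j))] has mean one, hence mean at most
   the inverse of [mass i D S] over [D]; by Jensen the biases are small. *)
Lemma sum_bias_le i D S (lam : R) : 0 < lam -> lam <= 2^-1 -> i \notin S ->
  0 < mass i D S ->
  lam * (\sum_(j | (j \notin S) && (i != j))
           Num.max 0 (mass i D S - mass i D (j |: S)%SET))
  <= mass i D S * (2 * lam ^+ 2 * n%:R - ln (mass i D S)).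
Proof.
move=> lam0 lam2 iS; set a := mass i D S => a0.
pose J : {set 'I_n} :=
  [set j | [&& j \notin S, i != j & mass i D (j |: S)%SET < a]]%SET.
pose v x := row_mass i x * (D x)%:R * plant S x.
pose Y x : R := \sum_(j in J) (1 - 2 * (x 0 j)%:R).
have v0 x : 0 <= v x by rewrite /v !mulr_ge0 ?row_mass_ge0 ?plant_ge0 ?ler0n.
have JP j : j \in J -> [/\ j \notin S, i != j & mass i D (j |: S)%SET < a].
  by rewrite inE => /and3P.
(* Positions outside [J] contribute zero; planting [j] multiplies the density by [2 x_j], so each
   remaining loss is the [v]-integral of [1 - 2 x_j]. *)
have -> : \sum_(j | (j \notin S) && (i != j))
           Num.max 0 (a - mass i D (j |: S)%SET) = \sum_x v x * Y x.
  rewrite (bigID (mem J)) /= addrC big1 ?add0r; last first.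
    move=> j /andP[/andP[jS ij]]; rewrite inE jS ij /= -leNgt => h.
    by apply/max_idPl; rewrite subr_le0.
  transitivity (\sum_(j in J) (a - mass i D (j |: S)%SET)).
    apply: eq_big => [j|j /andP[_ /JP[_ _ h]]].
      by case: (boolP (j \in J)) => [/JP[-> ->]|]; rewrite ?andbF.
    by apply/max_idPr; rewrite subr_ge0 ltW.
  transitivity (\sum_(j in J) \sum_x v x * (1 - 2 * (x 0 j)%:R)).
    apply: eq_bigr => j /JP[jS _ _]; rewrite -sumrB; apply: eq_bigr => x _.
    by rewrite plantU1 // /v; ring.
  by rewrite exchange_big; apply: eq_bigr => x _; rewrite /Y mulr_sumr.
have tilt : \sum_x v x * \prod_(j in J) (1 + lam * (1 - 2 * (x 0 j)%:R)) <= 1.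
  rewrite -[leRHS](@sum_plant_tilt i S J lam) //; last 2 first.
  - by apply/negP => /JP[_]; rewrite eqxx.
  - rewrite disjoint_sym disjoint_subset; apply/fintype.subsetP => j /JP[jS _ _].
    by rewrite inE.
  apply: ler_sum => x _; rewrite ler_wpM2r //.
    by apply: prodr_ge0 => j _; case: (x 0 j) => /=; lra.
  have := mulr_ge0 (row_mass_ge0 i x) (plant_ge0 S x); rewrite /v.
  by case: (D x); rewrite ?mulr1 // mulr0 mul0r.
(* Jensen in pointwise form: [expR] lies above its tangent at [- ln a], the best point for a measure
   [v] of total mass [a]. *)
have low x : a^-1 * (1 + lam * Y x - 2 * lam ^+ 2 * n%:R + ln a)
    <= \prod_(j in J) (1 + lam * (1 - 2 * (x 0 j)%:R)).
  apply: (@le_trans _ _ (expR (lam * Y x - 2 * lam ^+ 2 * n%:R))).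
    rewrite mulrC ler_pdivrMr // -[X in _ <= _ * X](lnK a0) -expRD.
    by apply: le_trans (expR_ge1Dx _); rewrite !addrA.
  apply: (@le_trans _ _ (expR (\sum_(j in J) (lam * (1 - 2 * (x 0 j)%:R)
             - 2 * (lam * (1 - 2 * (x 0 j)%:R)) ^+ 2)))).
    rewrite ler_expR sumrB -mulr_sumr lerB //.
    apply: (@le_trans _ _ (\sum_(j in J) 2 * lam ^+ 2)).
      by apply: ler_sum => j _; case: (x 0 j) => /=; nra.
    rewrite sumr_const -[leLHS]mulr_natr ler_wpM2l ?ler_nat; [by [] | by nra |].
    by rewrite -[leqRHS]card_ord max_card.
  rewrite expR_sum; apply: ler_prod => j _; rewrite expR_ge0 /=.
  by apply: expR_sub_le1D; case: (x 0 j) => /=; lra.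
have {tilt} := le_trans (ler_sum _ (fun x _ => ler_wpM2l (v0 x) (low x))) tilt.
have -> : \sum_x v x * (a^-1 * (1 + lam * Y x - 2 * lam ^+ 2 * n%:R + ln a)) =
  a^-1 * (\sum_x v x * (1 - 2 * lam ^+ 2 * n%:R + ln a) + lam * \sum_x v x * Y x).
  rewrite mulr_sumr -big_split /= mulr_sumr; apply: eq_bigr => x _; ring.
rewrite -mulr_suml -/(mass i D S) -/a mulrC ler_pdivrMr // mul1r; lra.
Qed.

Lemma mass_cost_ge0 (mu lam : R) : 0 <= mu -> mu <= 1 -> 0 < lam ->
  0 <= mu * (1 - ln mu) / lam + 2 * lam * n%:R * mu.
Proof.
move=> mu0 mu1 l0; rewrite addr_ge0 // !mulr_ge0 ?invr_ge0 ?(ltW l0) //.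
by rewrite subr_ge0 (le_trans (ln_le0 mu1)).
Qed.

(* A drop of [mass S] only matters for the deficit [max 0 (mu - mass S)] with
   weight [min mu (mass S) / mass S], which absorbs the [- ln (mass S)] of
   [sum_bias_le]; so the cost of adding a random position is independent of [S]. *)
Lemma sum_deficit_step i D S (lam : R) (mu := mass i D finset.set0) :
  0 < lam -> lam <= 2^-1 -> i \notin S ->
  \sum_(j | (j \notin S) && (i != j)) Num.max 0 (mu - mass i D (j |: S)%SET)
  <= \sum_(j | (j \notin S) && (i != j)) Num.max 0 (mu - mass i D S)
     + (mu * (1 - ln mu) / lam + 2 * lam * n%:R * mu).
Proof.
move=> l0 l2 iS; set a := mass i D S.
have mu0 : 0 <= mu := mass_ge0 _ _ _.
have mu1 : mu <= 1 by apply: mass_le1; rewrite finset.in_set0.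
have cost0 := mass_cost_ge0 mu0 mu1 l0.
have a0 : 0 <= a := mass_ge0 _ _ _.
have a1 : a <= 1 by apply: mass_le1.
have aj0 j : 0 <= mass i D (j |: S)%SET := mass_ge0 _ _ _.
have [mu_eq0|mu_neq0] := eqVneq mu 0.
  rewrite mu_eq0 big1 => [|j _]; last first.
    by apply/max_idPl; rewrite sub0r oppr_le0.
  by rewrite mu_eq0 in cost0; rewrite addr_ge0 // sumr_ge0 // => j _; rewrite le_max lexx.
have mup : 0 < mu by rewrite lt0r mu_neq0.
(* At mass zero the deficit is already maximal, while [sum_bias_le] needs positive mass. *)
have [a_eq0|a_neq0] := eqVneq a 0.
  rewrite -[leLHS]addr0 lerD //; apply: ler_sum => j _.
  by rewrite a_eq0 subr0 ge_max !le_max lexx gerBl aj0 orbT.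
have ap : 0 < a by rewrite lt0r a_neq0.
pose m := Num.min mu a.
have m0 : 0 <= m by rewrite le_min mu0.
have mmu : m <= mu by rewrite ge_min lexx.
(* With [b] the new mass: if [mu <= a] then [mu - b <= (mu / a) (a - b)]; otherwise [m / a = 1] and
   the two losses add up. *)
apply: (@le_trans _ _ (\sum_(j | (j \notin S) && (i != j))
   (Num.max 0 (mu - a) + m / a * Num.max 0 (a - mass i D (j |: S)%SET)))).
  apply: ler_sum => j _; have := aj0 j; move: (mass i D _) => b b0.
  have q1 : m / a <= 1 by rewrite ler_pdivrMr // mul1r ge_min lexx orbT.
  have q0 : 0 <= m / a by rewrite divr_ge0.
  have [ba|ab] := leP a b.
    have -> : Num.max 0 (a - b) = 0 by apply/max_idPl; rewrite subr_le0.
    rewrite mulr0 addr0.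
    by rewrite ge_max !le_max lexx /= lerB ?orbT.
  have -> : Num.max 0 (a - b) = a - b by apply/max_idPr; rewrite subr_ge0 ltW.
  rewrite ge_max; apply/andP; split.
    by rewrite addr_ge0 ?le_max ?lexx // mulr_ge0 // subr_ge0 ltW.
  rewrite /m in q0 q1 *; case: (leP mu a) q0 q1 => mua q0 q1.
    have -> : Num.max 0 (mu - a) = 0 by apply/max_idPl; rewrite subr_le0.
    by rewrite add0r mulrBr divfK // lerB // ler_piMl.
  have -> : Num.max 0 (mu - a) = mu - a by apply/max_idPr; rewrite subr_ge0 ltW.
  by rewrite divff // mul1r; lra.
rewrite big_split /= lerD2l -mulr_sumr.
have := sum_bias_le l0 l2 iS ap; rewrite -/a; set X := \sum_(j | _) _ => HX.
have {}HX : X <= a * (2 * lam ^+ 2 * n%:R - ln a) / lam.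
  by rewrite ler_pdivlMr // mulrC.
apply: (@le_trans _ _ (m / a * (a * (2 * lam ^+ 2 * n%:R - ln a) / lam))).
  by rewrite ler_wpM2l ?divr_ge0.
have -> : m / a * (a * (2 * lam ^+ 2 * n%:R - ln a) / lam) =
   m * (- ln a) / lam + 2 * lam * n%:R * m by field; rewrite a_neq0 gt_eqF.
apply: lerD; last by rewrite ler_wpM2l // !mulr_ge0 // ltW.
rewrite ler_wpM2r ?invr_ge0 1?ltW //.
rewrite /m; case: (leP mu a) => mua.
  have : ln mu <= ln a by rewrite ler_ln.
  nra.
(* For [a < mu] the tangent of [ln] at 1 gives [- a ln a <= mu - a - a ln mu]; this is the source of
   the [1] in [1 - ln mu]. *)
have : ln (mu / a) <= mu / a - 1
    by rewrite -{1}[mu / a](subrKC 1) le_ln1Dx // ltrBrDl subrr divr_gt0.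
rewrite lnM ?posrE ?invr_gt0 // lnV ?posrE // => h.
have lmu : ln mu <= 0 by apply: ln_le0.
have : a * (ln mu - ln a) <= mu - a.
  rewrite (_ : mu - a = a * (mu / a - 1)) ?ler_wpM2l //.
  by field.
nra.
Qed.

End RowMeasure.

(** * Averaging over random sets built one element at a time *)

Section Averaging.
Variables (R : realType) (n : nat).
Implicit Types (i j : 'I_n) (S C : {set 'I_n}) (F : {set 'I_n} -> R).

Lemma sum_setU1 (P : pred {set 'I_n}) j F :
  \sum_(C : {set 'I_n} | (j \in C) && P C) F C =
  \sum_(S : {set 'I_n} | (j \notin S) && P (j |: S)%SET) F (j |: S)%SET.
Proof.
rewrite (reindex_onto (fun S => (j |: S)%SET) (fun C => (C :\ j)%SET)) /=.
  apply: eq_bigl => S; rewrite setU11 /= andbC; congr (_ && _).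
  by apply/eqP/idP => [<-|/setU1K //]; rewrite setD11.
by move=> C /andP[jC _]; rewrite finset.setD1K.
Qed.

(** Double counting: any of the [s.+1] elements of a set may be the one added last. *)
Lemma sum_extend s i F :
  \sum_(S : {set 'I_n} | (i \notin S) && (#|S| == s))
     \sum_(j | (j \notin S) && (i != j)) F (j |: S)%SET
  = s.+1%:R * \sum_(S : {set 'I_n} | (i \notin S) && (#|S| == s.+1)) F S.
Proof.
rewrite mulr_sumr.
transitivity (\sum_(S : {set 'I_n} | (i \notin S) && (#|S| == s.+1)) \sum_(j in S) F S).
  rewrite (exchange_big_dep xpredT) //= [RHS](exchange_big_dep xpredT) //=.
  apply: eq_bigr => j _.
  transitivity (\sum_(C : {set 'I_n} | (j \in C) && ((i \notin C) && (#|C| == s.+1))) F C).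
    rewrite sum_setU1; apply: eq_bigl => S; rewrite !inE negb_or.
    case: (boolP (j \in S)) => jS; rewrite ?andbF //= cardsU1 jS eqSS.
    by rewrite -andbA andbC -andbA; case: (i != j); rewrite ?andbF //= andbC.
  by apply: eq_bigl => C; rewrite andbC.
by apply: eq_bigr => S /andP[_ /eqP<-]; rewrite sumr_const mulr_natl.
Qed.

Lemma card_not_mem s i S : i \notin S -> #|S| = s ->
  #|[pred j | (j \notin S) && (i != j)]| = (n - s.+1)%N.
Proof.
move=> iS cS; have -> : s.+1 = #|(i |: S)%SET| by rewrite cardsU1 iS cS.
rewrite -[n in (n - _)%N]card_ord -(cardsC (i |: S)%SET) addKn.
by apply: eq_card => j; rewrite !inE negb_or eq_sym andbC.
Qed.

(** Induction on [s]: the cost in [sum_deficit_step] is shared among at least [n - k] candidate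
    positions, so each of the [s] additions raises the mean deficit by at most cost [/ (n - k)]. *)
Lemma sum_deficit_le i (D : pred 'rV[bool]_n) (lam : R) (k s : nat)
    (mu := mass R i D finset.set0) :
  0 < lam -> lam <= 2^-1 -> (k < n)%N -> (s < k)%N ->
  \sum_(S : {set 'I_n} | (i \notin S) && (#|S| == s)) Num.max 0 (mu - mass R i D S)
  <= s%:R / (n - k)%:R * (mu * (1 - ln mu) / lam + 2 * lam * n%:R * mu)
     * \sum_(S : {set 'I_n} | (i \notin S) && (#|S| == s)) 1.
Proof.
move=> l0 l2 kn; set K := _ / lam + _.
have K0 : 0 <= K.
  by apply: mass_cost_ge0 => //; [exact: mass_ge0 | apply: mass_le1; rewrite finset.in_set0].
pose X s := \sum_(S : {set 'I_n} | (i \notin S) && (#|S| == s)) Num.max 0 (mu - mass R i D S).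
pose N s : R := \sum_(S : {set 'I_n} | (i \notin S) && (#|S| == s)) 1.
rewrite -/(X s) -/(N s).
have N0 t : 0 <= N t by apply: sumr_ge0.
elim: s => [_|s IH sk].
  rewrite !mul0r /X big1 // => S /andP[_]; rewrite cards_eq0 => /eqP ->.
  by rewrite subrr maxxx.
have nk0 : (0 : R) < (n - k)%:R by rewrite ltr0n subn_gt0.
have NS : s.+1%:R * N s.+1 = (n - s.+1)%:R * N s.
  rewrite -sum_extend mulr_sumr; apply: eq_bigr => S /andP[iS /eqP cS].
  by rewrite sumr_const (card_not_mem iS cS) mulr1.
have XS : s.+1%:R * X s.+1 <= (n - s.+1)%:R * X s + N s * K.
  rewrite -sum_extend mulr_sumr mulr_suml -big_split /=.
  apply: ler_sum => S /andP[iS /eqP cS].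
  apply: le_trans (sum_deficit_step D l0 l2 iS) _.
  by rewrite sumr_const (card_not_mem iS cS) mul1r [_%:R * Num.max _ _]mulr_natl.
have {}IH := IH (ltnW sk).
rewrite -(@ler_pM2l _ s.+1%:R) ?ltr0n //; apply: le_trans XS _.
rewrite mulrCA NS.
have Nk : N s * K <= (n - s.+1)%:R / (n - k)%:R * (N s * K).
  rewrite ler_peMl ?mulr_ge0 // ler_pdivlMr // mul1r ler_nat.
  by apply: leq_sub2l; exact: ltnW.
apply: (@le_trans _ _ ((n - s.+1)%:R * (s%:R / (n - k)%:R * K * N s)
   + (n - s.+1)%:R / (n - k)%:R * (N s * K))).
  by rewrite lerD // ler_wpM2l.
by rewrite -natr1 le_eqVlt; apply/orP; left; apply/eqP; ring.
Qed.

End Averaging.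

(** * A product inequality for one-sided losses *)

Section ProductDeficit.
Variables (R : realType) (I : finType).

(** Weierstrass product inequality; the induction also carries that the product lies in [[0, 1]]. *)
Lemma one_sub_sum_le_prod (e : I -> R) : (forall i, 0 <= e i <= 1) ->
  1 - \sum_i e i <= \prod_i (1 - e i).
Proof.
move=> e01.
suff : (0 <= \prod_i (1 - e i) <= 1) && (1 - \sum_i e i <= \prod_i (1 - e i)).
  by case/andP.
apply: (big_rec2 (fun s p => (0 <= p <= 1) && (1 - s <= p))).
  by rewrite ler01 lexx subr0 lexx.
move=> i s p _ /andP[/andP[p0 p1] h]; have /andP[e0 e1] := e01 i.
by apply/andP; split; [apply/andP; split|]; nra.
Qed.

(** If all [mu i] are positive, dividing by their product reduces this to the Weierstrass inequality
    for the relative losses [e i]; gains [m i > mu i] are discarded. *)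
Lemma prod_sub_le (mu m : I -> R) :
  (forall i, 0 <= mu i) -> (forall i, 0 <= m i) ->
  \prod_i mu i - \prod_i m i <=
  \sum_i Num.max 0 (mu i - m i) * \prod_(j | j != i) mu j.
Proof.
move=> mu0 m0.
case: (boolP [exists i, mu i == 0]) => [/existsP[i /eqP mui]|].
  rewrite (bigD1 i) //= mui mul0r sub0r (@le_trans _ _ 0) //.
    by rewrite oppr_le0 prodr_ge0.
  by apply: sumr_ge0 => j _; rewrite mulr_ge0 ?prodr_ge0 // le_max lexx.
rewrite negb_exists => /forallP mun0.
have mup i : 0 < mu i by rewrite lt0r mu0 andbT; exact: mun0.
pose e i := Num.max 0 (1 - m i / mu i).
have e01 i : 0 <= e i <= 1.
  by rewrite le_max lexx ge_max ler01 gerBl divr_ge0.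
have muE i : mu i * e i = Num.max 0 (mu i - m i).
  by rewrite /e maxr_pMr // mulr0 mulrBr mulr1 mulrCA divff // mulr1.
have me i : mu i * (1 - e i) <= m i.
  rewrite mulrBr mulr1 muE lerBlDr -lerBlDl.
  by rewrite le_max lexx orbT.
have -> : \sum_i Num.max 0 (mu i - m i) * \prod_(j | j != i) mu j
        = \prod_i mu i * \sum_i e i.
  rewrite mulr_sumr; apply: eq_bigr => i _.
  by rewrite -muE [in RHS](bigD1 i) //=; ring.
have : \prod_i mu i * \prod_i (1 - e i) <= \prod_i m i.
  rewrite -big_split /=; apply: ler_prod => i _; rewrite me andbT.
  by rewrite mulr_ge0 // subr_ge0; case/andP: (e01 i).
have := one_sub_sum_le_prod e01.
have : 0 <= \prod_i mu i by apply: prodr_ge0.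
nra.
Qed.

End ProductDeficit.

(** * Transcripts as products of row cells, and their entropy *)

Section Cells.
Variables (R : realType) (n : nat) (Pi : protocol n) (rho : randomness Pi).
Implicit Types (i j : 'I_n) (C : {set 'I_n}) (A : 'M[bool]_n).

Local Notation cell_index := ((rounds Pi).-tuple {ffun 'I_n -> bool}).
Implicit Types t : cell_index.

(** The history is read from [t] and not from a run, so the condition involves row [i] alone; this
    is what makes the event of a transcript a product. *)
Definition consistent (t : cell_index) i : pred 'rV[bool]_n := fun x =>
  [forall u : 'I_(rounds Pi), broadcast Pi i x (rho i) (take u t) == tnth t u i].

Lemma size_run A s : size (run A rho s) = s.
Proof. by elim: s => //= s IH; rewrite size_rcons IH. Qed.

Lemma take_run A u s : (u <= s)%N -> take u (run A rho s) = run A rho u.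
Proof.
elim: s => [|s IH]; first by rewrite leqn0 => /eqP ->.
rewrite leq_eqVlt => /predU1P[->|us]; first by rewrite take_oversize ?size_run.
by rewrite /= -cats1 takel_cat ?size_run // IH.
Qed.

Lemma run_consistent A t :
  reflect (run A rho (rounds Pi) = t) [forall i, consistent t i (row i A)].
Proof.
apply: (iffP forallP) => [cons|tE i].
  have E u : (u <= rounds Pi)%N -> run A rho u = take u t.
    elim: u => [|u IH] ur; first by rewrite take0.
    rewrite /= (take_nth [ffun=> false]) ?size_tuple // IH ?(ltnW ur) //.
    congr rcons; apply/ffunP => i; rewrite ffunE.
    have /forallP/(_ (Ordinal ur))/eqP := cons i.
    by rewrite (tnth_nth [ffun=> false]).
  by rewrite E // take_oversize ?size_tuple.
apply/forallP => u; rewrite (tnth_nth [ffun=> false]) -tE.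
rewrite take_run 1?ltnW // -(@nth_take u.+1) // take_run //= nth_rcons size_run.
by rewrite ltnn eqxx ffunE.
Qed.

(** Transcripts partition the matrices into products of cells, and rows are independent. Leaving [S]
    free covers the random and the planted laws at once. *)
Lemma sum_event (S : 'I_n -> {set 'I_n}) (G : transcript n -> bool) :
  \sum_(A : 'M[bool]_n) \prod_i (row_mass R i (row i A) * plant R (S i) (row i A)) *
     (G (protocol_transcript A rho))%:R
  = \sum_(t : cell_index) (G t)%:R * \prod_i mass R i (consistent t i) (S i).
Proof.
under [RHS]eq_bigr => t _ do rewrite -sum_matrix_prod mulr_sumr.
rewrite exchange_big; apply: eq_bigr => A _ /=.
have sz : size (run A rho (rounds Pi)) == rounds Pi by rewrite size_run.
rewrite [RHS](bigD1 (Tuple sz)) //= [X in _ = _ + X]big1 ?addr0 => [|t tA].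
  rewrite mulrC; congr (_ * _); apply: eq_bigr => i _; congr (_ * _).
  have /forallP/(_ i) -> := introT (run_consistent A (Tuple sz)) erefl.
  by rewrite mulr1.
have : ~~ [forall i, consistent t i (row i A)].
  by apply: contraNN tA => /run_consistent tE; apply/eqP/val_inj; rewrite /= tE.
rewrite negb_forall => /existsP[i ci].
by rewrite (bigD1 i) //= (negPf ci) mulr0 !mul0r mulr0.
Qed.

Lemma sum_prod_mass : \sum_(t : cell_index) \prod_i mass R i (consistent t i) finset.set0 = 1.
Proof.
have := sum_event (fun=> finset.set0) predT.
under [X in _ = X -> _]eq_bigr => t _ do rewrite mul1r.
move<-; under eq_bigr => A _ do rewrite mulr1.
rewrite (sum_matrix_prod (fun i x => row_mass R i x * plant R finset.set0 x)).
rewrite big1 // => i _.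
by rewrite sum_plant ?finset.in_set0.
Qed.

(* Given the rows of the other processors, a transcript is determined by the
   bits sent by processor [i]. *)
Lemma card_cells_off i A :
  (#|[pred t | [forall j, (j != i) ==> consistent t j (row j A)]]|
     <= 2 ^ rounds Pi)%N.
Proof.
pose f (t : cell_index) : (rounds Pi).-tuple bool := [tuple tnth t u i | u < rounds Pi].
rewrite -card_bool -card_tuple.
apply: (@leq_card_in _ _ f) => // t t' ht ht' ff'.
have E u : (u <= rounds Pi)%N -> take u t = take u t'.
  elim: u => [|u IH] ur; first by rewrite !take0.
  rewrite !(take_nth [ffun=> false]) ?size_tuple // IH ?(ltnW ur) //.
  congr rcons; rewrite -!(tnth_nth _ _ (Ordinal ur)); apply/ffunP => j.
  have [->|ji] := eqVneq j i.
    by have := congr1 (fun s => tnth s (Ordinal ur)) ff'; rewrite !tnth_mktuple.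
  move: ht ht'; rewrite !inE => /forallP/(_ j) + /forallP/(_ j).
  rewrite ji /= => /forallP/(_ (Ordinal ur))/eqP <- /forallP/(_ (Ordinal ur))/eqP <-.
  by rewrite /= IH // ltnW.
by apply/val_inj; have := E _ (leqnn _); rewrite !take_oversize ?size_tuple.
Qed.

(** The left side is the mean number of transcripts consistent with random rows of the processors
    other than [i], which [card_cells_off] bounds pointwise. *)
Lemma sum_prod_mass_off i :
  \sum_(t : cell_index) \prod_(j | j != i) mass R j (consistent t j) finset.set0
  <= 2 ^+ rounds Pi.
Proof.
have E t : \prod_(j | j != i) mass R j (consistent t j) finset.set0 =
    \sum_(A : 'M[bool]_n) (\prod_j row_mass R j (row j A)) *
      ([forall j, (j != i) ==> consistent t j (row j A)])%:R.
  transitivity (\prod_j mass R j (if j != i then consistent t j else predT) finset.set0).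
    rewrite [RHS](bigD1 i) //= eqxx mass_predT ?finset.in_set0 // mul1r.
    by apply: eq_bigr => j ->.
  rewrite -sum_matrix_prod; apply: eq_bigr => A _.
  case: (boolP [forall j, _]) => [/forallP h|].
    rewrite mulr1; apply: eq_bigr => j _; rewrite plant0 mulr1.
    by have := h j; case: (j != i) => /= [->|_]; rewrite mulr1.
  rewrite negb_forall => /existsP[j]; rewrite negb_imply => /andP[ji nj].
  by rewrite (bigD1 j) //= ji (negPf nj) mulr0 !mul0r mulr0.
under eq_bigr => t _ do rewrite E.
rewrite exchange_big /=.
apply: (@le_trans _ _ (\sum_(A : 'M[bool]_n) (\prod_j row_mass R j (row j A)) * 2 ^+ rounds Pi)).
  apply: ler_sum => A _; rewrite -mulr_sumr ler_wpM2l //.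
    by apply: prodr_ge0 => j _; exact: row_mass_ge0.
  rewrite -natr_sum -natrX ler_nat; apply: leq_trans (card_cells_off i A).
  rewrite -sum1_card [leqRHS]big_mkcond; apply: leq_sum => t _.
  by rewrite inE; case: [forall j, _].
rewrite -mulr_suml (sum_matrix_prod (row_mass R (n := n))) big1 ?mul1r // => j _.
rewrite -[RHS](@mass_predT R n j finset.set0) ?finset.in_set0 //.
by apply: eq_bigr => x _; rewrite plant0 !mulr1.
Qed.

(* The leading term is [1 - ln mu] averaged over transcripts, an entropy: the
   tangent line of [ln] at [2 ^- rounds Pi] reduces it to [sum_prod_mass_off]. *)
Lemma sum_entropy_le i (lam : R) : 0 < lam ->
  \sum_(t : cell_index) (\prod_(j | j != i) mass R j (consistent t j) finset.set0) *
    (mass R i (consistent t i) finset.set0 *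
       (1 - ln (mass R i (consistent t i) finset.set0)) / lam
     + 2 * lam * n%:R * mass R i (consistent t i) finset.set0)
  <= ((rounds Pi)%:R + 1) / lam + 2 * lam * n%:R.
Proof.
move=> l0.
pose mu t := mass R i (consistent t i) finset.set0.
pose Q t := \prod_(j | j != i) mass R j (consistent t j) finset.set0.
have Q0 t : 0 <= Q t by apply: prodr_ge0 => j _; exact: mass_ge0.
pose w : R := 2 ^+ rounds Pi.
have w0 : 0 < w by rewrite exprn_gt0.
have lnw : ln w <= (rounds Pi)%:R.
  by rewrite /w lnXn // ler_wMn2r //; apply: (@le_ln1Dx R 1); lra.
(* Use [ln v <= v - 1] at [v = (w * mu t)^-1]: its [- 1] absorbs the [1] in [1 - ln (mu t)]. *)
have key t : mu t * (1 - ln (mu t)) <= w^-1 + (rounds Pi)%:R * mu t.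
  have : 0 <= mu t by exact: mass_ge0.
  rewrite le_eqVlt => /predU1P[<-|m0].
    by rewrite mul0r mulr0 addr0 invr_ge0 ltW.
  have : ln ((w * mu t)^-1) <= (w * mu t)^-1 - 1.
    have h : 0 < (w * mu t)^-1 by rewrite invr_gt0 mulr_gt0.
    by rewrite -{1}[_^-1](subrKC 1) le_ln1Dx // ltrBrDl subrr.
  rewrite lnV ?posrE ?mulr_gt0 // lnM ?posrE // => h.
  have : mu t * (1 - ln (mu t)) <= mu t * ((w * mu t)^-1 + (rounds Pi)%:R).
    by apply: ler_wpM2l; [exact: ltW | lra].
  move/le_trans; apply; rewrite mulrDr [_ * (rounds Pi)%:R]mulrC lerD2r.
  by rewrite invfM mulrCA divff ?gt_eqF // mulr1.
have QM : \sum_(t : cell_index) Q t * mu t = 1.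
  rewrite -[RHS]sum_prod_mass; apply: eq_bigr => t _.
  by rewrite [RHS](bigD1 i) //= mulrC.
have QW : \sum_(t : cell_index) Q t <= w := sum_prod_mass_off i.
apply: (@le_trans _ _ (\sum_(t : cell_index) (Q t * (w^-1 / lam)
   + Q t * mu t * ((rounds Pi)%:R / lam + 2 * lam * n%:R)))).
  apply: ler_sum => t _; rewrite -/(mu t) -/(Q t) -[Q t * mu t * _]mulrA -mulrDr ler_wpM2l //.
  have -> : w^-1 / lam + mu t * ((rounds Pi)%:R / lam + 2 * lam * n%:R)
    = (w^-1 + (rounds Pi)%:R * mu t) / lam + 2 * lam * n%:R * mu t by ring.
  by rewrite lerD2r ler_pM2r ?invr_gt0.
rewrite big_split /= -!mulr_suml QM mul1r.
have : (\sum_(t : cell_index) Q t) * (w^-1 / lam) <= 1 / lam.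
  rewrite mulrA ler_pM2r ?invr_gt0 // ler_pdivrMr // mul1r //.
lra.
Qed.

End Cells.

(** * The gap between the random and planted laws for fixed coins *)

Section Gap.
Variables (R : realType) (n : nat).
Implicit Types (i j : 'I_n) (C : {set 'I_n}) (A : 'M[bool]_n).

Definition planted_positions C i : {set 'I_n} :=
  if i \in C then (C :\ i)%SET else finset.set0.

Lemma planted_positionsN C i : i \notin planted_positions C i.
Proof. by rewrite /planted_positions; case: ifP; rewrite ?setD11 ?finset.in_set0. Qed.

Lemma Arand_prod A : Arand R A =
  \prod_i (row_mass R i (row i A) * plant R finset.set0 (row i A)).
Proof.
apply: eq_bigr => i _; rewrite plant0 mulr1.
by apply: eq_bigr => j _; rewrite mxE.
Qed.

(** On the clique event all [plant] factors equal 2, and off it one vanishes. The product law has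
    total mass one, so [kappa] must be the inverse of the clique probability. *)
Lemma Aclique_prod C A : Aclique R C A =
  \prod_i (row_mass R i (row i A) * plant R (planted_positions C i) (row i A)).
Proof.
pose kappa : R := \prod_i \prod_(j in planted_positions C i) 2.
have E B : \prod_i (row_mass R i (row i B) * plant R (planted_positions C i) (row i B))
    = kappa * (if is_clique C B then Arand R B else 0).
  have -> : (if is_clique C B then Arand R B else 0) =
      Arand R B * (is_clique C B)%:R by case: ifP; rewrite ?mulr1 ?mulr0.
  rewrite Arand_prod; under [in RHS]eq_bigr => i _ do rewrite plant0 mulr1.
  rewrite big_split mulrCA; congr (_ * _).
  under eq_bigr => i _ do rewrite /plant big_split /=.
  rewrite big_split /=; congr (_ * _).
  case: (boolP (is_clique C B)) => [/forallP clB|].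
    apply: big1 => i _; apply: big1 => j; rewrite /planted_positions mxE.
    case: ifP => iC; last by rewrite finset.in_set0.
    rewrite !inE => /andP[ji jC]; have /implyP/(_ iC)/forallP/(_ j) := clB i.
    by rewrite jC eq_sym ji /= => ->.
  rewrite negb_forall => /existsP[i]; rewrite negb_imply => /andP[iC].
  rewrite negb_forall => /existsP[j]; rewrite !negb_imply => /and3P[jC ij Bij].
  rewrite (bigD1 i) //= (bigD1 j) /=; last first.
    by rewrite /planted_positions iC !inE eq_sym ij.
  by rewrite mxE (negPf Bij) !mul0r.
have tot : kappa * \sum_(B | is_clique C B) Arand R B = 1.
  rewrite big_mkcond mulr_sumr; under eq_bigr => B _ do rewrite -E.
  rewrite (sum_matrix_prod
    (fun i x => row_mass R i x * plant R (planted_positions C i) x)).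
  by rewrite big1 // => i _; rewrite sum_plant ?planted_positionsN.
rewrite /Aclique /conditioned E mulrC; congr (_ * _).
have S0 := lt0r_neq0 (clique_mass_gt0 R C).
by apply: (mulIf S0); rewrite tot mulVf.
Qed.

(** Sets avoiding [i] plant nothing in row [i]; removing [i] from the others leaves the sets of size
    [k - 1] treated by [sum_deficit_le]. *)
Lemma sum_deficit_clique i (D : pred 'rV[bool]_n) (lam : R) (k : nat)
    (mu := mass R i D finset.set0) :
  0 < lam -> lam <= 2^-1 -> (k < n)%N ->
  \sum_(C : {set 'I_n} | #|C| == k)
     Num.max 0 (mu - mass R i D (planted_positions C i))
  <= k%:R / (n - k)%:R * (mu * (1 - ln mu) / lam + 2 * lam * n%:R * mu)
     * \sum_(C : {set 'I_n} | (i \in C) && (#|C| == k)) 1.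
Proof.
move=> l0 l2 kn; set K := _ / lam + _.
have K0 : 0 <= K.
  by apply: mass_cost_ge0 => //; [exact: mass_ge0 | apply: mass_le1; rewrite finset.in_set0].
rewrite (bigID (fun C => i \in C)) /= [X in _ + X]big1 ?addr0; last first.
  by move=> C /andP[_ /negPf iC]; rewrite /planted_positions iC subrr maxxx.
under eq_bigl do rewrite andbC.
rewrite !sum_setU1.
case: k kn => [|k] kn.
  rewrite !big_pred0 ?mulr0 // => S; rewrite cardsU1;
  by case: (i \notin S).
have P (S : {set 'I_n}) : (i \notin S) && (#|(i |: S)%SET| == k.+1) = (i \notin S) && (#|S| == k).
  by rewrite cardsU1; case: (i \notin S).
under eq_bigl do rewrite P.
under [X in _ <= _ * X]eq_bigl do rewrite P.
under eq_bigr => S /andP[iS _].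
  rewrite /planted_positions setU11 finset.setU1K //; over.
rewrite /=; apply: le_trans (sum_deficit_le i D l0 l2 kn (ltnSn k)) _.
rewrite -/mu -/K ler_wpM2r ?sumr_ge0 // ler_wpM2r // ler_wpM2r ?invr_ge0 //.
by rewrite ler_nat.
Qed.

(** The weights [mu] come from the random law and are free of [C], so the sum over [C] moves inside,
    to single cells. One factor [k] counts the planted rows, the other bounds the positions planted
    in each. *)
Lemma event_gap_le (Pi : protocol n) (rho : randomness Pi)
    (G : transcript n -> bool) (k : nat) (lam : R) :
  0 < lam -> lam <= 2^-1 -> (k < n)%N ->
  \sum_(A : 'M[bool]_n) (Arand R A - Aplanted R k A) * (G (protocol_transcript A rho))%:R
  <= k%:R * k%:R / (n - k)%:R * (((rounds Pi)%:R + 1) / lam + 2 * lam * n%:R).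
Proof.
move=> l0 l2 kn.
pose cell := @consistent n Pi rho.
pose mu t i := mass R i (cell t i) finset.set0.
set B := (_ / lam + _).
pose M : R := #|[set C : {set 'I_n} | #|C| == k]%SET|%:R.
have M0 : 0 < M.
  by rewrite ltr0n card_draws card_ord bin_gt0 ltnW.
have ME : \sum_(C : {set 'I_n} | #|C| == k) 1 = M.
  by rewrite sumr_const /M cardsE.
rewrite -(ler_pM2r M0).
have -> : (\sum_(A : 'M[bool]_n) (Arand R A - Aplanted R k A) * (G (protocol_transcript A rho))%:R) * M
   = \sum_(C : {set 'I_n} | #|C| == k)
       \sum_(A : 'M[bool]_n) (Arand R A - Aclique R C A) * (G (protocol_transcript A rho))%:R.
  rewrite mulr_suml exchange_big; apply: eq_bigr => A _ /=.
  rewrite -mulr_suml sumrB mulrAC; congr (_ * _).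
  rewrite mulrBl /Aplanted -/M divfK ?gt_eqF //; congr (_ - _).
  by rewrite sumr_const -mulr_natr /M cardsE.
have gap C : \sum_(A : 'M[bool]_n) (Arand R A - Aclique R C A) * (G (protocol_transcript A rho))%:R
   <= \sum_t \sum_i Num.max 0 (mu t i - mass R i (cell t i) (planted_positions C i))
        * \prod_(j | j != i) mu t j.
  under eq_bigr => A _ do rewrite mulrBl Arand_prod Aclique_prod.
  rewrite sumrB (sum_event R rho (fun=> finset.set0) G).
  rewrite (sum_event R rho (planted_positions C) G) -sumrB; apply: ler_sum => t _; rewrite -mulrBr.
  have := prod_sub_le (mu := mu t)
    (m := fun i => mass R i (cell t i) (planted_positions C i))
    (fun i => mass_ge0 R i (cell t i) _) (fun i => mass_ge0 R i (cell t i) _).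
  rewrite -/cell; set X := \prod_i _ - _ => gapt.
  (* Nonnegativity lets the transcripts rejected by [G] be counted too. *)
  have S0 : 0 <= \sum_i Num.max 0 (mu t i - mass R i (cell t i) (planted_positions C i))
        * \prod_(j | j != i) mu t j.
    apply: sumr_ge0 => i _; rewrite mulr_ge0 ?le_max ?lexx //.
    by apply: prodr_ge0 => j _; exact: mass_ge0.
  by case: (G t); rewrite ?mul1r ?mul0r.
apply: le_trans (ler_sum _ (fun C _ => gap C)) _.
rewrite exchange_big /=; under eq_bigr => t _ do rewrite exchange_big /=.
pose N i : R := \sum_(C : {set 'I_n} | (i \in C) && (#|C| == k)) 1.
have N0 i : 0 <= N i by apply: sumr_ge0.
have NE : \sum_i N i = k%:R * M.
  rewrite /N (exchange_big_dep (fun C : {set 'I_n} => #|C| == k)) /=; last first.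
    by move=> i C _ /andP[].
  rewrite -ME mulr_sumr; apply: eq_bigr => C /eqP cC; rewrite mulr1 -cC -sum1_card natr_sum.
  by apply: eq_bigl => i; rewrite eqxx andbT.
apply: (@le_trans _ _ (\sum_i \sum_t k%:R / (n - k)%:R * N i *
   ((\prod_(j | j != i) mu t j) *
    (mu t i * (1 - ln (mu t i)) / lam + 2 * lam * n%:R * mu t i)))).
  rewrite exchange_big /=; apply: ler_sum => i _; apply: ler_sum => t _.
  rewrite -mulr_suml.
  apply: (@le_trans _ _ ((k%:R / (n - k)%:R *
      (mu t i * (1 - ln (mu t i)) / lam + 2 * lam * n%:R * mu t i) * N i) *
      \prod_(j | j != i) mu t j)).
    rewrite ler_wpM2r ?sum_deficit_clique //.
    by apply: prodr_ge0 => j _; exact: mass_ge0.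
  by rewrite le_eqVlt; apply/orP; left; apply/eqP; ring.
under eq_bigr => i _ do rewrite -mulr_sumr.
apply: (@le_trans _ _ (\sum_i k%:R / (n - k)%:R * N i * B)).
  apply: ler_sum => i _; rewrite ler_wpM2l ?mulr_ge0 ?invr_ge0 //.
  exact: sum_entropy_le.
rewrite -mulr_suml -mulr_sumr NE le_eqVlt; apply/orP; left; apply/eqP; ring.
Qed.

End Gap.

(** * From the gap to the success probability *)

Section Advantage.
Variables (R : realType) (n : nat) (Pi : protocol n).

(** The success probability is 1/2 plus half the gap averaged over the coins, so a bound for each
    fixed [rho] suffices. *)
Lemma success_le (guess : transcript n -> bool) (k : nat) (B : R) :
  (k <= n)%N ->
  (forall rho : randomness Pi,
     \sum_(A : 'M[bool]_n) (Arand R A - Aplanted R k A) *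
       (guess (protocol_transcript A rho))%:R <= B) ->
  success_probability Pi guess (@Arand R n) (@Aplanted R n k) <= 2^-1 + 2^-1 * B.
Proof.
move=> kn gapB; rewrite /success_probability big_bool /= -mulrDr.
have c0 : (0 : R) < #|randomness Pi|%:R.
  by rewrite ltr0n; apply/card_gt0P; exists [ffun=> [tuple false | _ < coins Pi]].
rewrite -big_split /=.
have -> : \sum_(A : 'M[bool]_n)
   (Arand R A * (\sum_(rho : randomness Pi)
      (guess (protocol_transcript A rho) == true)%:R / #|randomness Pi|%:R) +
    Aplanted R k A * (\sum_(rho : randomness Pi)
      (guess (protocol_transcript A rho) == false)%:R / #|randomness Pi|%:R)) =
   1 + (\sum_(rho : randomness Pi) \sum_(A : 'M[bool]_n)
      (Arand R A - Aplanted R k A) * (guess (protocol_transcript A rho))%:R)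
      / #|randomness Pi|%:R.
  rewrite exchange_big /= -[X in X + _](Aplanted_sum1 R kn) mulr_suml -big_split /=.
  apply: eq_bigr => A _; rewrite -!mulr_suml -mulr_sumr.
  have -> : \sum_(rho : randomness Pi) (guess (protocol_transcript A rho) == true)%:R
    = \sum_(rho : randomness Pi) (guess (protocol_transcript A rho))%:R :> R.
    by apply: eq_bigr => rho _; rewrite eqb_id.
  have -> : \sum_(rho : randomness Pi) (guess (protocol_transcript A rho) == false)%:R
    = #|randomness Pi|%:R - \sum_(rho : randomness Pi) (guess (protocol_transcript A rho))%:R :> R.
    rewrite -[#|_|]sum1_card natr_sum -sumrB; apply: eq_bigr => rho _.
    by case: (guess _); rewrite /= ?subrr ?subr0.
  by field; rewrite gt_eqF.
rewrite mulrDr mulr1 lerD2l ler_pM2l ?invr_gt0 // ler_pdivrMr //.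
apply: le_trans (ler_sum _ (fun rho _ => gapB rho)) _.
by rewrite sumr_const mulr_natr.
Qed.

End Advantage.

(* Used with [z = n ^ e] and [y = n ^ (1/2)]. *)
Lemma advantage_bound_small (R : realType) (n k r y z lam : R) :
  1 <= z -> 2 * z <= y -> n = y ^+ 2 -> 0 <= k -> k <= y / 2 ->
  k * k <= y / z ^+ 2 -> 0 <= r -> r <= z -> lam = z / y ->
  k * k / (n - k) * ((r + 1) / lam + 2 * lam * n) <= 8 / z.
Proof.
move=> z1 zy nE k0 ky kk r0 rz lamE.
have z0 : 0 < z by lra.
have y0 : 0 < y by lra.
have nk : y ^+ 2 / 2 <= n - k by nra.
(* The first term is at most [2 y] because [r + 1 <= 2 z]; the second equals [2 z y] and
   dominates. *)
have B : (r + 1) / lam + 2 * lam * n <= 4 * (z * y).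
  have -> : 2 * lam * n = 2 * (z * y) by rewrite lamE nE; field; rewrite gt_eqF.
  have : (r + 1) / lam <= 2 * y.
    rewrite lamE ler_pdivrMr ?divr_gt0 //.
    have -> : 2 * y * (z / y) = 2 * z by field; rewrite gt_eqF.
    lra.
  nra.
have B0 : 0 <= (r + 1) / lam + 2 * lam * n.
  have l0 : 0 < lam by rewrite lamE divr_gt0.
  have n0 : 0 <= n by rewrite nE sqr_ge0.
  by apply: addr_ge0; [apply: divr_ge0; lra | rewrite !mulr_ge0 // ltW].
have Q : k * k / (n - k) <= (y / z ^+ 2) / (y ^+ 2 / 2).
  apply: ler_pM => //; rewrite ?mulr_ge0 ?invr_ge0 //; first by nra.
  by rewrite lef_pV2 // posrE; nra.
have Q0 : 0 <= k * k / (n - k) by rewrite divr_ge0 ?mulr_ge0 //; nra.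
apply: le_trans (ler_pM Q0 B0 Q B) _.
rewrite le_eqVlt; apply/orP; left; apply/eqP; field.
by rewrite !gt_eqF.
Qed.

(** * Asymptotics in [n] and the contradiction *)

Local Open Scope classical_set_scope.
Local Open Scope ring_scope.

Lemma near_natr_powR_ge (R : realType) (e M : R) : 0 < e ->
  \forall n \near \oo, M <= n%:R `^ e.
Proof.
move=> e0; near=> n.
apply: (@le_trans _ _ (Num.max 0 M)); first by rewrite le_max lexx orbT.
have M0 : 0 <= Num.max 0 M by rewrite le_max lexx.
have -> : Num.max 0 M = (Num.max 0 M `^ e^-1) `^ e.
  by rewrite -powRrM mulVf ?gt_eqF // powRr1.
apply: ge0_ler_powR; rewrite ?nnegrE ?powR_ge0 ?ler0n //; first exact: ltW.
by near: n; exact: nbhs_infty_ger.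
Unshelve. all: by end_near.
Qed.

Theorem theorem1p1 (R : realType) (eps : R) (r : nat -> R)
    (eps_gt0 : 0 < eps) (r_small : n_pow_o1 r) :
  ~ exists (c : R) (Pi : forall n : nat, protocol n),
      [/\ 0 < c,
          (forall n : nat, (rounds (Pi n))%:R <= r n) &
          \forall n \near \oo, exists2 delta : R, c <= delta &
            distinguishes (Pi n) (@Arand R n)
              (@Aplanted R n (clique_size eps n)) delta].
Proof.
move=> [c [Pi [c0 rounds_le dist]]].
have [f [f0 rf]] := r_small.
(* The cap 1/8 gives [4 e <= 1/2], hence [z ^+ 4 <= y]; [e <= eps] keeps [k] below
   [n ^ (1/4 - e)]. *)
pose e := Num.min eps 8^-1.
have e0 : 0 < e by rewrite lt_min eps_gt0 invr_gt0 ltr0n.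
have eeps : e <= eps by rewrite ge_min lexx.
have e8 : e <= 8^-1 by rewrite ge_min lexx orbT.
have fe : \forall n \near \oo, f n <= e.
  have := cvgr_le 0 f0; apply; exact: e0.
suff : \forall n \near \oo, False by case=> N _ /(_ N); apply; exact: leqnn.
near=> n.
have [delta cd [guess succ]] : exists2 delta : R, c <= delta &
    distinguishes (Pi n) (@Arand R n) (@Aplanted R n (clique_size eps n)) delta.
  by near: n.
set k := clique_size eps n in succ.
pose x : R := n%:R; pose z : R := x `^ e; pose y : R := x `^ 2^-1.
have x1 : 1 <= x by rewrite ler1n; near: n; exact: nbhs_infty_gt.
have x0 : 0 < x by lra.
have xD a b : x `^ (a + b) = x `^ a * x `^ b.
  by rewrite powRD // (gt_eqF x0) /= implybT.
have z2 : 2 <= z by rewrite /z /x; near: n; exact: near_natr_powR_ge.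
(* Any constant above 4 works: the advantage will be at most [4 / z], half of [8 / z]. *)
have zc : 5 / c <= z by rewrite /z /x; near: n; exact: near_natr_powR_ge.
have zy4 : z ^+ 4 <= y.
  rewrite -powR_mulrn ?powR_ge0 // -powRrM; apply: ler_powR => //; lra.
have zz : 2 * z <= z ^+ 2 by rewrite expr2 ler_pM2r //; lra.
have zy : 2 * z <= y.
  have z4 : z ^+ 4 = z ^+ 2 * z ^+ 2 by rewrite -exprD.
  by nra.
have nE : x = y ^+ 2.
  have half2 : 2^-1 + 2^-1 = 1 :> R by lra.
  by rewrite expr2 -xD half2 powRr1 // ltW.
have kx : k%:R <= x `^ (4^-1 - e).
  apply: (@le_trans _ _ (x `^ (4^-1 - eps))); first by rewrite truncn_le powR_ge0.
  by apply: ler_powR => //; lra.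
have kk : k%:R * k%:R <= y / z ^+ 2.
  have -> : y / z ^+ 2 = x `^ (4^-1 - e) * x `^ (4^-1 - e).
    rewrite -powR_mulrn ?powR_ge0 // -powRrM -powRN -!xD; congr powR; lra.
  by rewrite ler_pM.
have ky : k%:R <= y / 2.
  apply: (@le_trans _ _ (y / z ^+ 2)).
    (* A natural number is at most its square. *)
    apply: le_trans kk; rewrite -natrM ler_nat; case: (k) => // m.
    by rewrite leq_pmulr.
  rewrite ler_wpM2l ?powR_ge0 // lef_pV2 ?posrE ?exprn_gt0 ?ltr0n //; nra.
have kn : (k < n)%N.
  by rewrite -(ltr_nat R) -/x; nra.
have rz : (rounds (Pi n))%:R <= z.
  apply: le_trans (rounds_le n) _.
  have -> : r n = n%:R `^ f n by near: n.
  by apply: ler_powR => //; near: n.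
have lam0 : 0 < z / y by rewrite divr_gt0 // powR_gt0.
have lam2 : z / y <= 2^-1 by rewrite ler_pdivrMr ?powR_gt0 //; lra.
have := success_le (ltnW kn)
  (fun rho : randomness (Pi n) => event_gap_le rho guess lam0 lam2 kn).
rewrite succ lerD2l natrB ?(ltnW kn) // => bound.
have := @advantage_bound_small R x k%:R (rounds (Pi n))%:R y z (z / y).
have z1 : 1 <= z by lra.
move=> /(_ z1 zy nE (ler0n _ _) ky kk (ler0n _ _) rz erefl) small.
have : c <= 4 / z.
  apply: (le_trans cd); apply: (le_trans bound).
  rewrite -/x; lra.
have zp : 0 < z by lra.
rewrite ler_pdivlMr // => h.
by move: zc; rewrite ler_pdivrMr // mulrC; lra.
Unshelve. all: by end_near.
Qed.
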